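(* Let $Y$ be a real topological vector space, $F\subseteq Y$, $a\in Y$, let $H$ be a proper closed subset of $Y$ and $k\in 0^+H\setminus\{0\}$. Then $M_{F,a,H,k}=M_{F,a+ck,H,k}$ for each $c\in\mathbb{R}$.
   Context: For $A\subseteq Y$, the recession cone is $0^+A:=\{u\in Y\mid A+\mathbb{R}_+u\subseteq A\}$, where $\mathbb{R}_+=[0,\infty)$. A proper subset of $Y$ is a nonempty subset different from $Y$. For $b\in Y$, $(P_{F,b,H,k})$ is the problem of minimizing $t$ over all pairs $(y,t)\in F\times\mathbb{R}$ with $y\in b-H+tk$ (the feasible solutions). $M_{F,b,H,k}$ is the set of its optimal solutions $y$, i.e. of all $y\in F$ for which there is $t\in\mathbb{R}$ such that $(y,t)$ is feasible and $t\le s$ for every feasible $(z,s)$. *)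

(* Defs.v *)
From HB Require Import structures.
From mathcomp Require Import all_boot all_order all_algebra.
From mathcomp Require Import all_classical all_reals all_analysis.

Set Implicit Arguments.
Unset Strict Implicit.
Unset Printing Implicit Defensive.

Import Order.TTheory GRing.Theory Num.Theory.
Import numFieldNormedType.Exports.

Local Open Scope classical_set_scope.
Local Open Scope ring_scope.

(* Differs from [classical_sets.proper]: the set is also required to be
   nonempty. *)
Definition proper_subset (T : Type) (A : set T) : Prop :=
  A !=set0 /\ A <> [set: T].

(* 0^+ A; in particular 0^+ set0 is the whole space. *)
Definition recession_cone (R : realType) (Y : lmodType R) (A : set Y) : set Y :=
  [set u | [set x + r *: u | x in A & r in `[0, +oo[] `<=` A].

(* Feasible pairs (y, t) of the problem P_{F,b,H,k}:
   minimize t subject to y \in F and y \in b - H + t k. *)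
Definition feasible (R : realType) (Y : lmodType R)
    (F : set Y) (b : Y) (H : set Y) (k : Y) : set (Y * R) :=
  [set yt | F yt.1 /\ [set b - h + yt.2 *: k | h in H] yt.1].

(* M_{F,b,H,k}: only the y-components of the optimal pairs are collected. *)
Definition optimal_solutions (R : realType) (Y : lmodType R)
    (F : set Y) (b : Y) (H : set Y) (k : Y) : set Y :=
  [set y | F y /\ exists t : R, feasible F b H k (y, t) /\
    forall (z : Y) (s : R), feasible F b H k (z, s) -> t <= s].

(* Main.v *)
(* Translating the base point by [c *: k] translates the t-component of every
   feasible pair by [- c], which preserves the minimizers. *)
Require Import Defs.
From mathcomp Require Import all_boot all_order all_algebra.
From mathcomp Require Import all_classical all_reals all_analysis.

Import Order.TTheory GRing.Theory Num.Theory.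
Import numFieldNormedType.Exports.

Local Open Scope classical_set_scope.
Local Open Scope ring_scope.

(** Since [b + c k - h + t k = b - h + (c + t) k], the pairs feasible for the two base points
    correspond by [(y, t) <-> (y, c + t)]. A constant offset of the objective leaves the optimal [y]
    unchanged. One inclusion, for all [b] and [c], suffices: [-c] undoes the shift. *)

Lemma feasible_shift (R : realType) (Y : lmodType R) (F : set Y) (b : Y)
    (H : set Y) (k : Y) (c : R) (y : Y) (t : R) :
  feasible F (b + c *: k) H k (y, t) <-> feasible F b H k (y, c + t).
Proof.
have shiftE h : b + c *: k - h + t *: k = b - h + (c + t) *: k.
  by rewrite scalerDl (addrAC b) addrA.
by split=> -[/= Fy [h Hh yE]]; split=> //=; exists h; rewrite // -yE shiftE.
Qed.

Lemma optimal_solutions_shift_sub (R : realType) (Y : lmodType R) (F : set Y)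
    (b : Y) (H : set Y) (k : Y) (c : R) :
  optimal_solutions F (b + c *: k) H k `<=` optimal_solutions F b H k.
Proof.
move=> y [Fy [t [/feasible_shift feas_t min_t]]]; split=> //.
exists (c + t); split=> // z s feas_s.
(* A competitor [(z, s)] for [b] becomes [(z, s - c)] for [b + c *: k], where [t] is minimal. *)
by rewrite -lerBrDl; apply: (min_t z); apply/feasible_shift; rewrite subrKC.
Qed.

Theorem proposition13 (R : realType) (Y : topologicalLmodType R)
    (F : set Y) (a : Y) (H : set Y) (k : Y)
    (properH : proper_subset H) (closedH : closed H)
    (hk : (recession_cone H `\ 0) k) :
  forall c : R,
    optimal_solutions F a H k = optimal_solutions F (a + c *: k) H k.
Proof.
move=> c; apply/seteqP; split; last exact: optimal_solutions_shift_sub.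
(* View [a] as the base point [a + c *: k] shifted by [- c]. *)
rewrite -[X in optimal_solutions F X H k `<=` _](addrK (c *: k)) -scaleNr.
exact: optimal_solutions_shift_sub.
Qed.
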